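(* Let $k\geq 3$ and let $2\leq n_1\leq n_2\leq \cdots\leq n_k$ be integers. The $n_1\times\cdots\times n_k$ chessboard has \emph{no} closed knight tour if and only if at least one of the following holds: (a) $n_i$ is odd for every $i\in\{1,\dots,k\}$; (b) $n_{k-1}=2$; (c) $n_k=3$.
   Context: The $n_1\times\cdots\times n_k$ chessboard is the set $\mathcal{B}=\{1,\dots,n_1\}\times\cdots\times\{1,\dots,n_k\}\subset\mathbb{Z}^k$. A knight move is a vector $c\in\mathbb{Z}^k$ having exactly one coordinate in $\{\pm1\}$, exactly one coordinate in $\{\pm 2\}$, and all other $k-2$ coordinates equal to $0$. The knight graph on $\mathcal{B}$ has an edge between $a,b\in\mathcal{B}$ iff $a-b$ is a knight move. A closed knight tour is a Hamiltonian cycle in this graph. *)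

(* Defs.v *)
From mathcomp Require Import all_boot.
Set Implicit Arguments. Unset Strict Implicit. Unset Printing Implicit Defensive.

Definition point (k : nat) := {ffun 'I_k -> nat}.

Definition on_board (k : nat) (n : 'I_k -> nat) (a : point k) : bool :=
  [forall i, (1 <= a i <= n i)%N].

Definition ndist (x y : nat) : nat := (x - y) + (y - x).

Definition knight_adj (k : nat) (a b : point k) : bool :=
  [&& #|[set i | ndist (a i) (b i) == 1]| == 1,
      #|[set i | ndist (a i) (b i) == 2]| == 1 &
      [forall i, [|| ndist (a i) (b i) == 0, ndist (a i) (b i) == 1 | ndist (a i) (b i) == 2]]].

Definition closed_knight_tour (k : nat) (n : 'I_k -> nat) (c : seq (point k)) : Prop :=
  [/\ (3 <= size c)%N, uniq c, all (on_board n) c,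
      (forall a : point k, on_board n a -> a \in c) &
      cycle (@knight_adj k) c].

Definition has_closed_knight_tour (k : nat) (n : 'I_k -> nat) : Prop :=
  exists c : seq (point k), closed_knight_tour n c.

(* Main.v *)
Require Import Defs.
From mathcomp Require Import all_boot.
Set Implicit Arguments. Unset Strict Implicit. Unset Printing Implicit Defensive.

(* No tour in cases (a), (b), (c): a knight move changes the parity of the sum of
   the coordinates; if all sides but the last are 2, moves preserve the parity of
   the last coordinate; if all sides are 2 or 3, the point (2, ..., 2) has no move.

   Existence: if two tours on disjoint boxes contain links xy and zw such that xz
   and yw are knight moves, exchanging these links merges the tours into one.
   - Stacking: a tour on a box containing two disjoint pairs of links that differ
     by steps of length 2 yields such a tour on the product of the box with
     {1, ..., m}, m >= 2. This reduces the theorem to three dimensions, where the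
     sides are the two largest ones and one more, chosen so that some side is even.
   - Three dimensions: tours containing prescribed links near their corners can be
     prolonged by 4 along each axis, which reduces a side >= 8 by 4 and leaves the
     39 boxes (up to the order of the axes) with sides at most 7, for which explicit
     tours are listed. *)

(** * Merging cycles *)

Section CyclicLinks.

Variable T : eqType.
Implicit Types (x y z w : T) (s c : seq T) (e f : T * T).

Definition flip_link e := (e.2, e.1).

(** Links are ordered pairs that stand for unoriented edges; equality of links here, and membership
    in a cycle in [linked], therefore disregard orientation. *)
Definition same_link e f := (e == f) || (e == flip_link f).

Definition links c := zip c (rot 1 c).

Definition linked c e := (e \in links c) || (flip_link e \in links c).

Lemma flip_linkK : involutive flip_link. Proof. by case. Qed.

Lemma linked_flip c e : linked c (flip_link e) = linked c e.
Proof. by rewrite /linked flip_linkK orbC. Qed.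

Lemma same_linkC e f : same_link e f = same_link f e.
Proof.
rewrite /same_link eq_sym; congr (_ || _).
by rewrite -(inj_eq (inv_inj flip_linkK)) flip_linkK eq_sym.
Qed.

Lemma cycle_links r c : cycle r c = all (fun e => r e.1 e.2) (links c).
Proof.
case: c => //= x s; rewrite /links rot1_cons.
by elim: s {1 3}x => [|y s IHs] z /=; rewrite ?IHs.
Qed.

Lemma links_rot n c : links (rot n c) = rot n (links c).
Proof.
rewrite /links rot_rot; set d := rot 1 c.
have sz_d : size c = size d by rewrite size_rot.
rewrite /rot zip_cat ?size_drop ?sz_d //; congr (_ ++ _).
  elim: n (c) (d) sz_d => [|n IHn] [|a c'] [|b d'] //= [sz]; exact: IHn.
by elim: n (c) (d) => [|n IHn] [|a c'] [|b d'] //=; rewrite IHn.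
Qed.

(** Reversal turns [rot 1] into [rotr 1], so the links of the reversed list are those of a rotation
    of [c], each one flipped. *)
Lemma links_rev c e : (e \in links (rev c)) = (flip_link e \in links c).
Proof.
have -> : links (rev c) = rev (zip c (rotr 1 c)).
  by rewrite /links rev_zip ?size_rotr // rev_rotr.
have -> : zip c (rotr 1 c) = map flip_link (zip (rotr 1 c) c).
  by elim: (c) (rotr 1 c) => [|x s IHs] [|y t] //=; rewrite IHs.
rewrite mem_rev -{1}(flip_linkK e) mem_map; last exact: can_inj flip_linkK.
have -> : zip (rotr 1 c) c = links (rotr 1 c) by rewrite /links rotrK.
by rewrite links_rot mem_rot.
Qed.

Lemma links_cons x s : links (x :: s) = rcons (zip (x :: s) s) (last x s, x).
Proof.
by rewrite /links rot1_cons; elim: s {1 3 4}x => [|y s IHs] z /=; rewrite ?IHs.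
Qed.

(** The cycle is rotated, and reversed first if it runs through the link from [x] to [y], until it
    starts at [x] and ends at [y]; the link is then the closing one. *)
Lemma linked_open c x y : linked c (x, y) ->
  exists s, [/\ perm_eq (x :: s) c, last x s = y & linked (x :: s) =1 linked c].
Proof.
have main c' : (y, x) \in links c' ->
  exists s, [/\ perm_eq (x :: s) c', last x s = y & linked (x :: s) =1 linked c'].
  (* Rotating by the position of the link plus one puts it last among the links, the place where
     [links_cons] exhibits the closing link. *)
  case/splitPr def_l: _ / => [l1 l2].
  have := links_rot (size l1).+1 c'; rewrite def_l /rot.
  rewrite -cat_rcons drop_size_cat ?take_size_cat ?size_rcons // -rcons_cat.
  rewrite -/(rot _ c'); set n := (size l1).+1.
  have perm_c : perm_eq (rot n c') c' by rewrite perm_rot.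
  have lk_c : linked (rot n c') =1 linked c'.
    by move=> e; rewrite /linked !links_rot !mem_rot.
  case: (rot n c') perm_c lk_c => [_ _|a s perm_c lk_c]; first by case: (l2 ++ l1).
  by rewrite links_cons => /rcons_inj[_ <- <-]; exists s.
case/orP=> [xy_c|]; last exact: main.
have [|s [perm_s last_s lk_s]] := main (rev c); first by rewrite links_rev.
exists s; split=> //; first by rewrite perm_sym -perm_rev perm_sym.
by move=> e; rewrite lk_s /linked !links_rev flip_linkK orbC.
Qed.

Lemma zip_path_cat x s z t :
  zip (x :: s ++ z :: t) (s ++ z :: t)
  = zip (x :: s) s ++ (last x s, z) :: zip (z :: t) t.
Proof. by elim: s x => [|y s IHs] x //=; rewrite IHs. Qed.

Lemma links_cat x s z t e :
  (e \in links ((x :: s) ++ z :: t)) =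
  [|| e \in zip (x :: s) s, e \in zip (z :: t) t, e == (last x s, z)
    | e == (last z t, x)].
Proof.
rewrite cat_cons links_cons last_cat /= zip_path_cat mem_rcons inE mem_cat inE.
by do !bool_congr; rewrite orbCA orbC orbA.
Qed.

(* Deleting the links [xy] and [zw] opens both cycles into paths; the new links
   [xz] and [yw] close these up into one cycle. *)
Lemma glue_cycles c1 c2 x y z w :
    linked c1 (x, y) -> linked c2 (z, w) ->
  exists c, [/\ perm_eq c (c1 ++ c2),
    forall e, linked c1 e -> ~~ same_link e (x, y) -> linked c e,
    forall e, linked c2 e -> ~~ same_link e (z, w) -> linked c e &
    forall e, linked c e ->
      [|| linked c1 e, linked c2 e, same_link e (x, z) | same_link e (y, w)]].
Proof.
move=> /linked_open[s [perm_s last_s lk_s]].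
(* The second cycle is opened as a path from [w] to [z], so that in the concatenation [w] follows
   [y] and the end [z] closes up to [x]. *)
rewrite -linked_flip => /linked_open[t [perm_t last_t lk_t]].
exists ((x :: s) ++ w :: t); split; first exact: perm_cat.
- move=> [a b]; rewrite -lk_s /linked links_cons !mem_rcons !inE !links_cat.
  rewrite last_s /same_link /flip_link /= !xpair_eqE.
  by case/orP=> /orP[/andP[/eqP-> /eqP->]|->]; rewrite ?eqxx ?orbT.
- move=> [a b]; rewrite -lk_t /linked links_cons !mem_rcons !inE !links_cat.
  rewrite last_t /same_link /flip_link /= !xpair_eqE.
  by case/orP=> /orP[/andP[/eqP-> /eqP->]|->]; rewrite ?eqxx ?orbT.
move=> e; rewrite -lk_s -lk_t /linked !links_cat !links_cons !mem_rcons !inE.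
rewrite last_s last_t /same_link /flip_link; case: e => a b /=.
rewrite !xpair_eqE.
case/orP=> /or4P[->|->|/andP[/eqP-> /eqP->]|/andP[/eqP-> /eqP->]];
  by rewrite ?eqxx ?orbT.
Qed.

End CyclicLinks.

Lemma links_map (T U : eqType) (h : T -> U) c :
  links (map h c) = [seq (h e.1, h e.2) | e <- links c].
Proof.
rewrite /links -map_rot; elim: c (rot 1 c) => [|x s IHs] [|y t] //=.
by rewrite IHs.
Qed.

Lemma linked_map (T U : eqType) (h : T -> U) c e :
  linked c e -> linked (map h c) (h e.1, h e.2).
Proof.
rewrite /linked links_map => /orP[] H; apply/orP; [left|right].
  by apply/mapP; exists e.
by apply/mapP; exists (flip_link e).
Qed.

(** * Knight tours on boxes *)

(** Points are lists of coordinates, so that adding an axis is a [cons] and the dimension can vary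
    in an induction. *)
Definition dists (p q : seq nat) := [seq ndist u.1 u.2 | u <- zip p q].

Definition kadj (p q : seq nat) :=
  let d := dists p q in
  [&& count_mem 1 d == 1, count_mem 2 d == 1 & all (leq^~ 2) d].

(** As [all2] rejects lists of different lengths, lying on the board also fixes the dimension, which
    the truncating [zip] in [dists] does not. *)
Definition onb (ds p : seq nat) := all2 (fun n x => 0 < x <= n) ds p.

Definition tour (ds : seq nat) (c : seq (seq nat)) : Prop :=
  [/\ 2 < size c, uniq c, cycle kadj c & forall p, (p \in c) = onb ds p].

Definition map_link (T U : Type) (h : T -> U) (e : T * T) := (h e.1, h e.2).

Lemma ndistC x y : ndist x y = ndist y x.
Proof. by rewrite /ndist addnC. Qed.

Lemma distsC p q : dists p q = dists q p.
Proof.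
by rewrite /dists; elim: p q => [|x p IHp] [|y q] //=; rewrite IHp ndistC.
Qed.

Lemma kadjC p q : kadj p q = kadj q p.
Proof. by rewrite /kadj distsC. Qed.

Lemma ndistDr m x y : ndist (x + m) (y + m) = ndist x y.
Proof. by rewrite /ndist !subnDr. Qed.

Lemma kadj_cons x y p q x' y' :
  ndist x y = ndist x' y' -> kadj (x :: p) (y :: q) = kadj (x' :: p) (y' :: q).
Proof. by move=> eq_d; rewrite /kadj /= eq_d. Qed.

Definition shift m (p : seq nat) := if p is x :: p' then x + m :: p' else p.

Lemma shift_inj m : injective (shift m).
Proof. by case=> [|x p] [|y q] //= [/addIn-> ->]. Qed.

Lemma kadj_shift m p q : kadj (shift m p) (shift m q) = kadj p q.
Proof.
case: p q => [|x p] [|y q] //=.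
exact/kadj_cons/ndistDr.
Qed.

Lemma mem_shift m n ds p c : (forall q, (q \in c) = onb (n :: ds) q) ->
  (p \in map (shift m) c)
    = (if p is x :: q then (m < x <= n + m) && onb ds q else false).
Proof.
move=> mem_c; apply/mapP/idP => [[q]|].
  rewrite mem_c; case: q => //= x q /andP[/andP[x_gt0 x_le] q_b] ->.
  by rewrite q_b -{1}[m]add0n ltn_add2r x_gt0 leq_add2r x_le.
case: p => //= x p /andP[/andP[x_gt x_le] p_b]; exists (x - m :: p).
  by rewrite mem_c /= p_b subn_gt0 x_gt leq_subLR addnC x_le.
by rewrite /= subnK // ltnW.
Qed.

Lemma linked_kadj c e : cycle kadj c -> linked c e -> kadj e.1 e.2.
Proof.
rewrite cycle_links => /allP kadj_c /orP[/kadj_c //|/kadj_c /=].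
by rewrite kadjC.
Qed.

Lemma cycle_linked c : (forall e, linked c e -> kadj e.1 e.2) -> cycle kadj c.
Proof.
move=> kadj_c; rewrite cycle_links; apply/allP=> e e_c.
by apply: kadj_c; rewrite /linked e_c.
Qed.

(** The second box, translated by [n1] along the first axis, is disjoint from the first box and
    completes it to a box with side [n1 + n2]; translation preserves knight moves, so [glue_cycles]
    applies. *)
Lemma glue_tours n1 n2 ds c1 c2 x y z w :
    tour (n1 :: ds) c1 -> tour (n2 :: ds) c2 ->
    linked c1 (x, y) -> linked c2 (z, w) ->
    kadj x (shift n1 z) -> kadj y (shift n1 w) ->
  exists c, [/\ tour (n1 + n2 :: ds) c,
    forall e, linked c1 e -> ~~ same_link e (x, y) -> linked c e &
    forall e, linked c2 e -> ~~ same_link e (z, w) ->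
      linked c (map_link (shift n1) e)].
Proof.
move=> [gt2_c1 uniq_c1 cyc_c1 mem_c1] [gt2_c2 uniq_c2 cyc_c2 mem_c2].
move=> xy_c1 zw_c2 xz yw; set d := map (shift n1) c2.
have zw_d : linked d (shift n1 z, shift n1 w) by apply: (linked_map _ zw_c2).
have cyc_d : cycle kadj d.
  rewrite cycle_links links_map all_map; move: cyc_c2; rewrite cycle_links.
  by apply: sub_all => e /=; rewrite kadj_shift.
have [c [perm_c lk1 lk2 lkc]] := glue_cycles xy_c1 zw_d.
exists c; split=> // [|e e_c2 e_zw].
  split.
  - by rewrite (perm_size perm_c) size_cat ltn_addr.
  - rewrite (perm_uniq perm_c) cat_uniq uniq_c1 map_inj_uniq ?uniq_c2 ?andbT /=.
      apply/hasPn=> p; rewrite (mem_shift _ _ mem_c2) mem_c1 /=.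
      by case: p => //= a p /andP[/andP[lt_a _] _]; rewrite [a <= _]leqNgt lt_a andbF.
    exact: shift_inj.
  - apply: cycle_linked => e /lkc/or4P[]; first exact: linked_kadj.
    + exact: linked_kadj.
    + by case/orP=> /eqP-> //=; rewrite kadjC.
    + by case/orP=> /eqP-> //=; rewrite kadjC.
  - move=> p; rewrite (perm_mem perm_c) mem_cat (mem_shift _ _ mem_c2) mem_c1.
    case: p => //= a p; case: (onb ds p); rewrite ?andbF // !andbT [n2 + n1]addnC.
    case: (posnP a) => [->//|a_gt0] /=; case: (leqP a n1) => //= le_a.
    by rewrite (leq_trans le_a) ?leq_addr.
apply: lk2; first exact: linked_map.
move: e_zw; rewrite /same_link /map_link /flip_link !xpair_eqE.
by rewrite !(inj_eq (@shift_inj n1)).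
Qed.

(** * Stacking layers along a new axis *)

(* [site e f] says that the endpoints of [e] and [f] differ pairwise by twice a
   unit vector, so that lifting [f] to the next layer makes them knight moves. *)
Definition site (e f : seq nat * seq nat) :=
  kadj (0 :: e.1) (1 :: f.1) && kadj (0 :: e.2) (1 :: f.2).

Definition distinct_links (es : seq (seq nat * seq nat)) :=
  pairwise (fun e f => ~~ same_link e f) es.

(** Two sites are required because stacking spends the first one and passes on the second. The list
    [hs] holds links reserved for other gluings, which the sites must avoid. *)
Definition sited (hs : seq (seq nat * seq nat)) (c : seq (seq nat)) : Prop :=
  exists e1 f1 e2 f2, let es := [:: e1; f1; e2; f2] in
  [/\ all (linked c) es, site e1 f1 && site e2 f2, distinct_links es
    & allrel (fun e f => ~~ same_link e f) es hs].

Lemma onb_cons1 ds p :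
  onb (1 :: ds) p = if p is x :: q then (x == 1) && onb ds q else false.
Proof. by case: p => [|[|[|x]] p]. Qed.

Lemma tour_layer ds c : tour ds c -> tour (1 :: ds) (map (cons 1) c).
Proof.
case=> gt2_c uniq_c cyc_c mem_c; split; first by rewrite size_map.
- by rewrite map_inj_uniq // => p q [].
- rewrite cycle_links links_map all_map; move: cyc_c; rewrite cycle_links.
  by apply: sub_all => e /=.
move=> p; rewrite onb_cons1; apply/mapP/idP => [[q q_c ->]|].
  by rewrite eqxx -mem_c.
by case: p => // x p /andP[/eqP-> p_b]; exists p; rewrite ?mem_c.
Qed.

Lemma same_link_cons (m : nat) (e f : seq nat * seq nat) :
  same_link (map_link (cons m) e) (map_link (cons m) f) = same_link e f.
Proof. by rewrite /same_link !xpair_eqE !eqseq_cons eqxx. Qed.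

Lemma same_link_cons_neq (m n : nat) (e f : seq nat * seq nat) : m != n ->
  same_link (map_link (cons m) e) (map_link (cons n) f) = false.
Proof. by move=> /negPf mn; rewrite /same_link !xpair_eqE !eqseq_cons mn. Qed.

Lemma site_cons m e f :
  site (map_link (cons m) e) (map_link (cons m) f) = site e f.
Proof. by rewrite /site /kadj /= /ndist !subnn. Qed.

(* Copies of the tour in consecutive layers are glued along the first site; the
   second site survives in the bottom layer and in the top layer, and this gives
   back two disjoint sites. *)
Lemma stack ds c m : tour ds c -> sited [::] c -> 2 <= m ->
  exists c', tour (m :: ds) c' /\ sited [::] c'.
Proof.
move=> tour_c [e1 [f1 [e2 [f2 /= [lk sites dl _]]]]].
case/and5P: lk => e1_c f1_c e2_c f2_c _; case/andP: sites => site1 site2.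
move: (dl); rewrite /distinct_links /= !andbT.
case/and3P=> /and3P[e1f1 e1e2 e1f2] /andP[f1e2 f1f2] e2f2.
have layer e : linked c e -> linked (map (cons 1) c) (map_link (cons 1) e).
  exact: linked_map.
(* Invariant for [k.+1] layers: [e1] is still available in the top layer for the next gluing, and
   the second site is present both in the bottom layer and in the top one. *)
have stacked k : exists t, tour (k.+1 :: ds) t /\
    all (linked t) [:: map_link (cons k.+1) e1; map_link (cons 1) e2;
      map_link (cons 1) f2; map_link (cons k.+1) e2; map_link (cons k.+1) f2].
  elim: k => [|k [t [tour_t /and5P[e1_t e2_1 f2_1 e2_k /andP[f2_k _]]]]].
    exists (map (cons 1) c); split; first exact: tour_layer.
    by rewrite /= !layer.
  have up p q : kadj (0 :: p) (1 :: q) -> kadj (k.+1 :: p) (1 + k.+1 :: q).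
    by rewrite (@kadj_cons k.+1 (1 + k.+1) _ _ 0 1) // -{1}[k.+1]add0n ndistDr.
  have /andP[/up up1 /up up2] := site1.
  have [t' [tour_t' keep_t keep_c]] :=
    glue_tours tour_t (tour_layer tour_c) e1_t (layer _ f1_c) up1 up2.
  have top e : linked c e -> ~~ same_link e f1 ->
      linked t' (map_link (cons k.+2) e).
    move=> e_c ef; have := keep_c _ (layer _ e_c); rewrite same_link_cons.
    by move/(_ ef); rewrite /map_link /= add1n.
  have bottom e : linked t (map_link (cons 1) e) -> ~~ same_link e e1 ->
      linked t' (map_link (cons 1) e).
    (* Only for a single layer do bottom and top coincide, and then the link must differ from the
       deleted [e1]; otherwise the layers already differ. *)
    move=> e_t ee; apply: keep_t => //; case: (k) => [|j].
      by rewrite same_link_cons.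
    by rewrite same_link_cons_neq.
  exists t'; split; first by rewrite -[k.+2]addn1.
  by rewrite /= !top ?bottom // same_linkC.
(* Since there are at least two layers, the two copies of the second site lie in different layers
   and so have no link in common. *)
case: m => [|[|m]] // _; have [t [tour_t]] := stacked m.+1.
case/and5P=> _ e2_1 f2_1 e2_m /andP[f2_m _]; exists t; split=> //.
exists (map_link (cons 1) e2), (map_link (cons 1) f2).
exists (map_link (cons m.+2) e2), (map_link (cons m.+2) f2).
split; rewrite ?allrel0r //=; first exact/and5P.
  by rewrite !site_cons site2.
by rewrite /distinct_links /= !same_link_cons e2f2.
Qed.

(** * Prolonging three-dimensional tours *)

Definition swap01 (p : seq nat) := if p is x :: y :: q then y :: x :: q else p.

Definition swap12 (p : seq nat) := if p is x :: q then x :: swap01 q else p.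

(* A link of [head_tops] is a diagonal of a 2 x 3 rectangle in the last layer along
   the first axis, and the corresponding link of [head_bottoms] is the other
   diagonal of that rectangle in the first layer: when a box is put on top of
   another one, the endpoints of the two diagonals are knight moves apart. The box
   on top always has height 4, hence the condition [_ == 4] in [bottoms]; it is
   enough that one of its two candidate diagonals occurs, since the box below has
   all its [tops]. *)
Definition head_tops a b c : seq (seq nat * seq nat) :=
  (if (4 <= a) && (3 <= c) then [:: ([:: a; 1; 1], [:: a; 2; 3])] else [::]) ++
  (if (4 <= a) && (3 <= b) then [:: ([:: a; 1; 1], [:: a; 3; 2])] else [::]).

Definition head_bottoms b c : seq (seq nat * seq nat) :=
  (if 3 <= c then [:: ([:: 1; 1; 3], [:: 1; 2; 1])] else [::]) ++
  (if 3 <= b then [:: ([:: 1; 3; 1], [:: 1; 1; 2])] else [::]).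

(** The same links are wanted along all three axes: [swap01] moves the first axis to the second
    place, and [swap12 \o swap01] moves it to the last. *)
Definition tops a b c :=
  head_tops a b c ++ map (map_link swap01) (head_tops b a c) ++
  map (map_link (swap12 \o swap01)) (head_tops c a b).

Definition bottoms (P : pred (seq nat * seq nat)) a b c :=
  [&& (a == 4) ==> has P (head_bottoms b c),
      (b == 4) ==> has P (map (map_link swap01) (head_bottoms a c)) &
      (c == 4) ==> has P (map (map_link (swap12 \o swap01)) (head_bottoms a b))].

(** The sites avoid the [tops] because a prolongation deletes one of the latter. *)
Definition extensible a b c t :=
  [/\ tour [:: a; b; c] t, all (linked t) (tops a b c),
      bottoms (linked t) a b c & sited (tops a b c) t].

Lemma all_head_tops P a b c : all P (head_tops a b c) =
  ((4 <= a) && (3 <= c) ==> P ([:: a; 1; 1], [:: a; 2; 3])) &&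
  ((4 <= a) && (3 <= b) ==> P ([:: a; 1; 1], [:: a; 3; 2])).
Proof. by rewrite all_cat; do 2!case: ifP => _ /=; rewrite ?andbT. Qed.

Lemma has_head_bottoms P b c : has P (head_bottoms b c) =
  (3 <= c) && P ([:: 1; 1; 3], [:: 1; 2; 1]) ||
  (3 <= b) && P ([:: 1; 3; 1], [:: 1; 1; 2]).
Proof. by rewrite has_cat; do 2!case: ifP => _ /=; rewrite ?orbF. Qed.

Lemma all_tops P a b c : all P (tops a b c) =
  [&& ((4 <= a) && (3 <= c) ==> P ([:: a; 1; 1], [:: a; 2; 3])) &&
      ((4 <= a) && (3 <= b) ==> P ([:: a; 1; 1], [:: a; 3; 2])),
      ((4 <= b) && (3 <= c) ==> P ([:: 1; b; 1], [:: 2; b; 3])) &&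
      ((4 <= b) && (3 <= a) ==> P ([:: 1; b; 1], [:: 3; b; 2])) &
      ((4 <= c) && (3 <= b) ==> P ([:: 1; 1; c], [:: 2; 3; c])) &&
      ((4 <= c) && (3 <= a) ==> P ([:: 1; 1; c], [:: 3; 2; c]))].
Proof.
rewrite /tops all_cat all_head_tops; congr (_ && _).
by rewrite all_cat !all_map !all_head_tops.
Qed.

Lemma bottomsE P a b c : bottoms P a b c =
  [&& (a == 4) ==> (3 <= c) && P ([:: 1; 1; 3], [:: 1; 2; 1]) ||
                   (3 <= b) && P ([:: 1; 3; 1], [:: 1; 1; 2]),
      (b == 4) ==> (3 <= c) && P ([:: 1; 1; 3], [:: 2; 1; 1]) ||
                   (3 <= a) && P ([:: 3; 1; 1], [:: 1; 1; 2]) &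
      (c == 4) ==> (3 <= b) && P ([:: 1; 3; 1], [:: 2; 1; 1]) ||
                   (3 <= a) && P ([:: 3; 1; 1], [:: 1; 2; 1])].
Proof. by rewrite /bottoms !has_map !has_head_bottoms. Qed.

(** * Symmetry under permutations of the axes *)

(** The prescribed links form a family that is symmetric in the axes: in the explicit form only the
    order of the conjuncts changes. *)
Lemma all_tops_swap01 P a b c :
  all P (tops b a c) = all (P \o map_link swap01) (tops a b c).
Proof.
by rewrite !all_tops /= andbCA; congr [&& _, _ & _]; rewrite andbC.
Qed.

Lemma all_tops_swap12 P a b c :
  all P (tops a c b) = all (P \o map_link swap12) (tops a b c).
Proof.
by rewrite !all_tops /= [X in _ && X = _]andbC; congr [&& _, _ & _]; rewrite andbC.
Qed.

Lemma bottoms_swap01 P a b c :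
  bottoms P b a c = bottoms (P \o map_link swap01) a b c.
Proof.
rewrite !bottomsE /= andbCA; congr [&& _, _ & _ ==> _]; by rewrite orbC.
Qed.

Lemma bottoms_swap12 P a b c :
  bottoms P a c b = bottoms (P \o map_link swap12) a b c.
Proof.
rewrite !bottomsE /= [X in _ && X = _]andbC; congr [&& _ ==> _, _ & _].
by rewrite orbC.
Qed.

Lemma sub_bottoms (P Q : pred (seq nat * seq nat)) a b c :
  subpred P Q -> bottoms P a b c -> bottoms Q a b c.
Proof.
move=> PQ /and3P[A B C]; apply/and3P; split; apply/implyP=> eq4.
- exact: sub_has PQ _ (implyP A eq4).
- exact: sub_has PQ _ (implyP B eq4).
- exact: sub_has PQ _ (implyP C eq4).
Qed.

(** Being a knight move depends only on the multiset of coordinate distances; this is why permuting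
    the axes preserves tours. *)
Lemma kadj_perm p q p' q' :
  perm_eq (dists p q) (dists p' q') -> kadj p q = kadj p' q'.
Proof.
move=> eq_d; rewrite /kadj (perm_all _ eq_d).
by move/permP: eq_d => eq_d; rewrite !eq_d.
Qed.

Lemma linked_mem (T : eqType) (c : seq T) e : linked c e -> (e.1 \in c) && (e.2 \in c).
Proof.
have in_links f : f \in links c -> (f.1 \in c) && (f.2 \in c).
  rewrite -(mem_rot 1 c f.2) /links.
  elim: c (rot 1 c) => [|x s IHs] [|y t] //=; rewrite !inE.
  case/predU1P=> [-> /=|/IHs/andP[-> ->]]; first by rewrite !eqxx.
  by rewrite !orbT.
by case/orP=> /in_links //=; rewrite andbC.
Qed.

Lemma tour_size ds c p : tour ds c -> p \in c -> size p = size ds.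
Proof. by case=> _ _ _ mem_c; rewrite mem_c /onb all2E => /andP[/eqP]. Qed.

Lemma site_perm p q p' q' r s r' s' :
  perm_eq (dists p q) (dists p' q') -> perm_eq (dists r s) (dists r' s') ->
  site (p, r) (q, s) = site (p', r') (q', s').
Proof.
by move=> eq1 eq2; rewrite /site /=; congr (_ && _); apply: kadj_perm;
   rewrite /= perm_cons.
Qed.

Section Reflect.

Variable h : seq nat -> seq nat.
Hypothesis hK : involutive h.
(** The lengths are fixed because [zip] truncates: for lists of unequal lengths, an exchange of axes
    can alter the multiset of distances. *)
Hypothesis h_dists : forall p q, size p = 3 -> size q = 3 ->
  perm_eq (dists (h p) (h q)) (dists p q).

Lemma tour_reflect ds ds' t : size ds = 3 ->
  (forall p, onb ds' p = onb ds (h p)) -> tour ds t -> tour ds' (map h t).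
Proof.
move=> ds3 eq_b tour_t; case: (tour_t) => gt2_t uniq_t cyc_t mem_t; split.
- by rewrite size_map.
- by rewrite map_inj_uniq //; apply: inv_inj.
- rewrite cycle_links links_map all_map; move: cyc_t; rewrite cycle_links.
  move/allP=> cyc_t; apply/allP=> e e_t /=.
  have /linked_mem/andP[e1 e2] : linked t e by rewrite /linked e_t.
  rewrite (kadj_perm (h_dists _ _)) ?(tour_size tour_t) //; exact: cyc_t.
by move=> p; rewrite -{1}[p]hK mem_map ?mem_t ?eq_b //; apply: inv_inj.
Qed.

Lemma same_link_reflect e f :
  same_link (map_link h e) (map_link h f) = same_link e f.
Proof. by rewrite /same_link !xpair_eqE !(inj_eq (inv_inj hK)). Qed.

Lemma extensible_reflect a b c a' b' c' t :
    (forall p, onb [:: a'; b'; c'] p = onb [:: a; b; c] (h p)) ->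
    (forall P, all P (tops a' b' c') = all (P \o map_link h) (tops a b c)) ->
    (forall P, bottoms P a' b' c' = bottoms (P \o map_link h) a b c) ->
  extensible a b c t -> extensible a' b' c' (map h t).
Proof.
move=> eq_b eq_tops eq_bots [tour_t tops_t bots_t].
case=> e1 [f1 [e2 [f2 /= [lk sites dl dl_tops]]]].
split; first exact: tour_reflect tour_t.
- by rewrite eq_tops; apply: sub_all tops_t => e /=; apply: linked_map.
- by rewrite eq_bots; apply: sub_bottoms bots_t => e /=; apply: linked_map.
have size3 e : linked t e -> (size e.1 = 3) * (size e.2 = 3).
  by case/linked_mem/andP=> e1_t e2_t; rewrite !(tour_size tour_t).
exists (map_link h e1), (map_link h f1), (map_link h e2), (map_link h f2).
case/and5P: lk => e1_t f1_t e2_t f2_t _.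
split.
- by rewrite /= !linked_map.
- move: sites e1_t f1_t e2_t f2_t; case: (e1) (f1) (e2) (f2).
  move=> p q [p' q'] [r s] [r' s'] sites /size3/=[] ? ? /size3/=[] ? ?.
  move=> /size3/=[] ? ? /size3/=[] ? ?.
  by rewrite /map_link !(site_perm (h_dists _ _) (h_dists _ _)).
- by move: dl; rewrite /distinct_links /= !same_link_reflect.
move: dl_tops; rewrite /allrel /= !eq_tops.
congr [&& _, _, _, _ & _]; apply: eq_all => e /=; by rewrite same_link_reflect.
Qed.

End Reflect.

Lemma swap01K : involutive swap01. Proof. by case=> [|x [|y p]]. Qed.

Lemma swap12K : involutive swap12.
Proof. by case=> //= x p; rewrite swap01K. Qed.

Lemma extensible_swap01 a b c t :
  extensible a b c t -> extensible b a c (map swap01 t).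
Proof.
apply: extensible_reflect; first exact: swap01K.
- move=> [|x [|y [|z []]]] // [|x' [|y' [|z' []]]] // _ _.
  by rewrite /dists /= (perm_catCA [:: _] [:: _] [:: _]).
- by case=> [|x [|y p]] //=; rewrite ?andbF //= andbCA.
- by move=> P; apply: all_tops_swap01.
- by move=> P; apply: bottoms_swap01.
Qed.

Lemma extensible_swap12 a b c t :
  extensible a b c t -> extensible a c b (map swap12 t).
Proof.
apply: extensible_reflect; first exact: swap12K.
- move=> [|x [|y [|z []]]] // [|x' [|y' [|z' []]]] // _ _.
  by rewrite /dists /= perm_cons (perm_catCA [:: _] [:: _] [::]).
- case=> [|x [|y [|z p]]] //=; rewrite ?andbF //; congr (_ && _).
  by rewrite andbCA.
- by move=> P; apply: all_tops_swap12.
- by move=> P; apply: bottoms_swap12.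
Qed.

(** * Adding four layers to a box *)

(** The box of height 4 is put on top along the first axis. The prolonged tour takes its [tops]
    along that axis from the upper box, and its other [tops], its [bottoms] and its sites from the
    lower box. *)
Lemma extend a b c t1 t2 : 4 <= a ->
    extensible a b c t1 -> extensible 4 b c t2 ->
  exists t, extensible (a + 4) b c t.
Proof.
move=> a_ge4 [tour1 tops1 bots1 site1] [tour2 tops2 bots2 _].
(* The upper tour has one of its two candidate diagonals; the side condition that comes with it puts
   the matching diagonal among the [tops] of the lower box. *)
have [x [y [z [w [xy_tops zw_t2 /andP[z1 w1] /andP[xz yw]]]]]] :
    exists x y z w, [/\ (x, y) \in head_tops a b c, linked t2 (z, w),
      (nth 0 z 0 == 1) && (nth 0 w 0 == 1) &
      kadj x (shift a z) && kadj y (shift a w)].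
  move: bots2; rewrite bottomsE /= => /andP[+ _].
  rewrite /head_tops a_ge4 /= => /orP[] /andP[ge3 lk]; rewrite ge3.
    exists [:: a; 1; 1], [:: a; 2; 3], [:: 1; 1; 3], [:: 1; 2; 1].
    rewrite lk mem_head /kadj /dists /=; split=> //.
    by rewrite -[ndist a _](ndistDr 0) ?addn0 -{1 3 5 7 9 11}[a]add0n !ndistDr.
  exists [:: a; 1; 1], [:: a; 3; 2], [:: 1; 3; 1], [:: 1; 1; 2].
  rewrite lk mem_cat mem_head orbT /kadj /dists /=; split=> //.
  by rewrite -{1 3 5 7 9 11}[a]add0n !ndistDr.
have [x_a y_a] : nth 0 x 0 = a /\ nth 0 y 0 = a.
  by move: xy_tops; rewrite /head_tops a_ge4 /=; do 2!case: ifP => _ //=;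
     rewrite ?inE ?orbF; try case/orP; move/eqP=> [-> ->].
have xy_t1 : linked t1 (x, y).
  by move: tops1; rewrite all_cat => /andP[/allP/(_ _ xy_tops)].
have [t [tour_t keep1 keep2]] := glue_tours tour1 tour2 xy_t1 zw_t2 xz yw.
(* The link deleted from the lower tour lies within layer [a], and the one deleted from the upper
   tour within its layer 1; a link with an endpoint outside that layer survives. *)
have keep1' e : linked t1 e -> (nth 0 e.1 0 != a) || (nth 0 e.2 0 != a) ->
    linked t e.
  move=> e_t1 e_a; apply: keep1 e_t1 _; apply: contraL e_a.
  by case/orP=> /eqP-> /=; rewrite x_a y_a eqxx.
have keep2' e : linked t2 e -> (nth 0 e.1 0 != 1) -> linked t (map_link (shift a) e).
  move=> e_t2 e_a; apply: keep2 e_t2 _; apply: contraL e_a; rewrite negbK.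
  by case/orP=> /eqP-> /=.
have [aF aF4] : (1 == a) = false /\ (a + 4 == 4) = false.
  by case: (a) a_ge4 => [|[|[|[|a']]]] //; rewrite addnC.
(* Both [a] and [a + 4] are at least 3, so the prolongation creates no new requirement along the
   other two axes. *)
have a3 : 3 <= a by apply: ltnW.
have a43 : 3 <= a + 4 by apply: leq_trans a3 (leq_addr _ _).
exists t; split=> //.
- move: tops1 tops2; rewrite !all_tops /= a3 a43 !andbT => /and3P[_ B C].
  case/andP=> A _; apply/and3P; split.
  (* The links wanted in layer [a + 4] are the shifted links of layer 4 of the upper box. *)
  + rewrite addnC leq_addr; case/andP: A => A1 A2.
    apply/andP; split; apply/implyP; first by move/(implyP A1)/keep2'; apply.
    by move/(implyP A2)/keep2'; apply.
  + case/andP: B => B1 B2; apply/andP; split; apply/implyP.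
      by move/(implyP B1)/keep1'; rewrite /= aF; apply.
    by move/(implyP B2)/keep1'; rewrite /= aF; apply.
  + case/andP: C => C1 C2; apply/andP; split; apply/implyP.
      by move/(implyP C1)/keep1'; rewrite /= aF; apply.
    by move/(implyP C2)/keep1'; rewrite /= aF; apply.
(* As [a + 4] is not 4, nothing is required along the first axis; each candidate along the others
   has an endpoint in layer 1, which is not layer [a]. *)
- move: bots1; rewrite !bottomsE aF4 a3 a43 /= => /and3P[_ b4 c4].
  apply/andP; split; apply/implyP.
    by case/(implyP b4)/orP=> [/andP[->]|] /keep1'; rewrite /= aF ?orbT => ->;
      rewrite ?orbT.
  by case/(implyP c4)/orP=> [/andP[->]|] /keep1'; rewrite /= aF ?orbT => ->;
    rewrite ?orbT.
case: site1 => e1 [f1 [e2 [f2 [lk sites dl dl_tops]]]].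
exists e1, f1, e2, f2; split=> //.
  apply/allP=> e e_in; apply: keep1; first exact: (allP lk).
  apply: (allrelP dl_tops) => //; by rewrite mem_cat xy_tops.
rewrite /allrel; apply/allP=> e e_in.
have /linked_mem/andP[e_t1 _] := allP lk _ e_in.
(* The new [tops] along the first axis lie in layer [a + 4], above the whole lower box, and hence
   differ from the links of its sites. *)
have low : (nth 0 e.1 0 == a + 4) = false.
  case: tour1 => _ _ _ mem1; move: e_t1; rewrite mem1.
  case: (e.1) => [|p0 p] /=; first by rewrite eq_sym addn_eq0 andbF.
  case/andP=> /andP[_ le_a] _.
  by rewrite ltn_eqF // addnS ltnS (leq_trans le_a) ?leq_addr.
have : all (fun f => ~~ same_link e f) (tops a b c).
  by apply/allP=> f f_tops; apply: (allrelP dl_tops).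
have new p q r s : ~~ same_link e ([:: a + 4; p; q], [:: a + 4; r; s]).
  by apply: contraFN low => /orP[] /eqP-> /=.
rewrite all_tops /= a3 => tops_e; rewrite all_tops /= !new !implybT a43 /=.
by case/and3P: tops_e => _ ->.
Qed.

(** * Tours on small boxes *)

(** Decimal literals keep the tours compact: they are parsed to digit lists instead of huge unary
    numbers, and each coordinate, being at most 7, is one digit. *)
Fixpoint digits (u : Decimal.uint) : seq nat :=
  match u with
  | Decimal.Nil => [::]
  | Decimal.D0 u' => 0 :: digits u'
  | Decimal.D1 u' => 1 :: digits u'
  | Decimal.D2 u' => 2 :: digits u'
  | Decimal.D3 u' => 3 :: digits u'
  | Decimal.D4 u' => 4 :: digits u'
  | Decimal.D5 u' => 5 :: digits u'
  | Decimal.D6 u' => 6 :: digits u'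
  | Decimal.D7 u' => 7 :: digits u'
  | Decimal.D8 u' => 8 :: digits u'
  | Decimal.D9 u' => 9 :: digits u'
  end.

Definition number_digits (u : Number.uint) :=
  if u is Number.UIntDecimal v then digits v else [::].

Fixpoint points (s : seq nat) : seq (seq nat) :=
  if s is x :: y :: z :: s' then [:: x; y; z] :: points s' else [::].

Definition certificate : Type :=
  (nat * nat * nat) * Number.uint * seq Number.uint.

Definition cert_dims (k : certificate) := k.1.1.

Definition cert_tour (k : certificate) :=
  points (flatten (map number_digits k.2)).

Definition cert_sites (k : certificate) := points (number_digits k.1.2).

(** A form of [extensible] that can be decided by evaluation: exhaustion of the box is replaced by a
    count of [a * b * c] distinct points on it. *)
Definition valid_cert (k : certificate) :=
  let: (a, b, c) := cert_dims k in let t := cert_tour k in let l := links t in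
  let lk e := (e \in l) || (flip_link e \in l) in
  [&& 2 < size t, size t == a * b * c, all (onb [:: a; b; c]) t, uniq t,
      all (fun e => kadj e.1 e.2) l, all lk (tops a b c), bottoms lk a b c &
    if cert_sites k is [:: p1; q1; p2; q2; p3; q3; p4; q4] then
      let es := [:: (p1, q1); (p2, q2); (p3, q3); (p4, q4)] in
      [&& all lk es,
          site (p1, q1) (p2, q2) && site (p3, q3) (p4, q4),
          distinct_links es &
          allrel (fun e f => ~~ same_link e f) es (tops a b c)]
    else false].

Local Delimit Scope dec_uint_scope with uint.

(* Each entry lists the sides, the endpoints of the four links of two disjoint
   sites, and the vertices of the tour, with one decimal digit per coordinate. *)
Definition small_certs : seq certificate := [::
  ((2, 3, 4)%N, 124112122114214222212224,
   [:: 111132124112232134214222234114122224212233113121133231223211131123221213]);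
  ((2, 3, 5)%N, 223211221213211232213234,
   [:: 111231212114135215113121133125223211232224122134115235214222124112131123;
       225233221213234132]);
  ((2, 3, 6)%N, 132212112232212224214222,
   [:: 111132212224122134126114216136115235214222124226234215236116135123225213;
       221233131112232211223125113121133231]);
  ((2, 3, 7)%N, 236116216136116137136117,
   [:: 111132212231133114126134122224232112214226124222234215236116137217115123;
       135127225237117136216235227125223121113211131233221213]);
  ((2, 4, 4)%N, 223244221242244232242234,
   [:: 111123144132124143241222142121223244232134113211131112214233221242234114;
       122141243224212231133213]);
  ((2, 4, 5)%N, 245233225213213115211113,
   [:: 111132212231133114135215234242144125223143122224245233225213115235214134;
       113211131112232244142121241222124145243141221123]);
  ((2, 4, 6)%N, 114212116214212132232112,
   [:: 111123115235223215135143122141243222241121142134146244236116214226245125;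
       113211131112232224216136124145126114212132144242234246225233221213133231]);
  ((2, 4, 7)%N, 227147225127147135145133,
   [:: 111231212224144132234246227147135143245226247235216237117215236244223125;
       137116124136115217225127146134142121241222214112131233113211232213221242;
       122114126145133141243123]);
  ((2, 5, 5)%N, 222124242122124145144125,
   [:: 111123221141243222124145225213115235155143241121133231151253232251153255;
       234215135114212224245233131112214134122242254152144125113211223244142154;
       252132]);
  ((2, 5, 6)%N, 255243235223243123223125,
   [:: 111213115136256244124226146134155235223125245143122141221242234222142121;
       241233212231151253133114216224126145225246144156254152232112214116236215;
       113211131251153255243123135154252132]);
  ((2, 5, 7)%N, 253155255157256136236116,
   [:: 111132212231252154133125227147126134122224245143151253155235256136216114;
       234246144242223244225237117215113211131112124116236257137217115127146226;
       247255157145153251243141221233214222241121142123135156254152232213]);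
  ((2, 6, 6)%N, 143245145225245224265244,
   [:: 111213221141162264166246225145243262142222241161263251131211113121133154;
       135215223125144136216235256244265253155143245224126114122242261163151231;
       212233252132124116236156254266164152232112214226234255153165146134115123]);
  ((2, 6, 7)%N, 156236136216236257256237,
   [:: 111231212233252154166264162143155167247127225217115213221141261163243255;
       153165157145265253151132113121142262164266245226234215227125223211232152;
       144246267147135156236257137235216136117237256244146134254242122224126114;
       133112214116124222241161263251131123]);
  ((2, 7, 7)%N, 253155251153162264164262,
   [:: 111123225244142222241121223231133152171273252154256136234253155143162264;
       272251153233221242261141243163265145166174254262164266245125113211131112;
       124116214226146167247127135237117215236156276255175277157176274172151271;
       173161263275267165177257137217115134122114216235227147126246144132212224;
       232213]);
  ((3, 3, 4)%N, 322224324222224212222214,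
   [:: 111213311112232334313332133121322224212231223321122312333134113314234114;
       324222214233221323124132331211131123]);
  ((3, 3, 6)%N, 134232132212232334212314,
   [:: 111321333314212132322112133114234226124136216224126336135233225213221323;
       113215335134232334214222324312122332313325223235315125326116236316115123;
       131211331121311231]);
  ((3, 4, 4)%N, 214312234332122332322132,
   [:: 111213333132322334232244124222142134214312122332234114324123313112133323;
       311121331343144224344242223143241233221341131211113314212231243141342321]);
  ((3, 4, 5)%N, 322112122312112133312333,
   [:: 111213311231333312122114313321241121223343331132124314322112133125113211;
       131143245224212233214222324332234215335134232244142341221323342141243345;
       225145344242144334315235115325135123]);
  ((3, 4, 6)%N, 144136344336136346134146,
   [:: 111123131341243141342222241321333231311121142332212224122114216235214226;
       234246126145133323315125144136346334124244324343223325245143344336135215;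
       335314326116236316115213225345146134232112313233221242322132113211331312]);
  ((3, 4, 7)%N, 246326226346345146343144,
   [:: 111312113211232334322242221341333231212314216237117327247226346147227347;
       245125324244225246326345146336126134236224344325317127337136144343335316;
       214235115213133121142222234132331233241321131112311323342141243145124116;
       137217315114122332313215223143135123]);
  ((3, 5, 6)%N, 332353132153353143351141,
   [:: 111213234132153251232211113134126246225244346354252154256136216314212114;
       315336146345155356254156355253151352142332353143124112131123324125133343;
       223325135255243224326116236215313233245226214235115316335145344242221341;
       322334144152342222241121311323122321333231351141331312]);
  ((3, 6, 6)%N, 234354236356354164352162,
   [:: 111312113211313215135156366345265246166356236116326314216114212224126316;
       115325346266364154146226214112232251331121311213221341322343223125315336;
       256136124244225323133334144132252233335255263161362264344363351152353332;
       234354164365245253355165153145243163155134254235333231151352162361241222;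
       324123142262342141261242122143131321]);
  ((3, 6, 7)%N, 345364325344364165366167,
   [:: 111312214235216336357167366156135116317127146226247367166147267365346266;
       254262164152351231243251131112232211331141261341322121113132212114126316;
       115217137347157255353143122242223321241233225145124244342354144125324343;
       133334355257236134335356155136337345364165245253333314326224344325313332;
       142222234215227246265163151352153363162361263161362264252154256237117327;
       315323311213221123]);
  ((4, 4, 4)%N, 441422421222422212442232,
   [:: 111132331121113211131112311413214312414334144224434314124244142341243141;
       342444324114234222421442232431443424412332313433223321441422212231333143;
       241233221213423411432242122134344323133343322123]);
  ((4, 4, 5)%N, 322123122323123221143223,
   [:: 111231432411423431311413425345144125315235115325445343441422414435245444;
       324114135215335415434442241233212332313112214312331433421222124145225244;
       342141243323122224344134142341322123221242443424412314234132333213232334;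
       133121113211223143131321]);
  ((4, 4, 6)%N, 333345133343135114133112,
   [:: 111312232422443242144246126316436415216136115134146336416435333345135114;
       212224236116326446344145243141342132322424214235223343133112131332412431;
       311213414334124314434426445244346325313215335323225233245125315413432411;
       423222324444234226425433331211113121142123221341421442241143122321441231]);
  ((4, 4, 7)%N, 326246346226246225446245,
   [:: 111231212413311121113211421442241143131341221422441321342141243444436417;
       227147337316115235133332122114216314124325135233313123324343322334315327;
       117237447435234136144345326246225424344242443323425224414215335433223125;
       245446236426445244434415427226346145126336416217137347146127247437317116;
       214112232134142222412213333431423411432312331132]);
  ((4, 5, 5)%N, 222214224212214424414224,
   [:: 111231311413315323225123333435443422221242432411423213234222214424322334;
       313233212224414312122332344134324114133112232442421341131321223215135143;
       241343144125335415434235115325245455254444425345155354153255353154252451;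
       331251441433445453355145243141342152351431452253151352454244142121113211;
       412314124132]);
  ((4, 5, 6)%N, 315413115213214226414426,
   [:: 111321441251452431351141342222412211113121311112131152232422221213115316;
       414426216415313123144132153255456354434455353143124145335323443242223215;
       416314333435315413425235214226234336135334436424445325346444243341322343;
       324345225246126224326116236134146356344446454244256136155253151352142154;
       355156254453432411423442252332212231421433331451241233245125133114122312]);
  ((4, 5, 7)%N, 226234224236435355455357,
   [:: 111213414422212231441321131123142341322132124112311413421211113121241451;
       331251153352151253333314416226234435355154133235247327117237436457337127;
       225246447257456437317116214424412222342323443455357156144343335354256136;
       346444324336344356146244236224425446454334326125245347137145157255243345;
       353332434426445325313215135114216415427217315417227147126316115134155143;
       223433452431423411432233221242122141351152254453252442232312]);
  ((4, 6, 6)%N, 151143351141143333145133,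
   [:: 111312122114126316414426434224216136326116236156346466256336146165355435;
       423411432334315125113121311431452354164365166356436455254246144264245233;
       153134155235223422221242322424412211131112232352162363261462454244265163;
       243433353154344332252442421231151143333341142262364345225123324222241253;
       443323133145124132212413214415313321441361463451331141351152342444456266;
       465453461251263161362343335255135325445464366446425226234215416314115213]);
  ((4, 6, 7)%N, 135325137125325126125326,
   [:: 111321241222342334322132252442423411432453333312331433452251232253245165;
       157347467266364244223143122323133343153354456255445365346156357437425444;
       324336234215227147135325126114216417337316335136155134344356254455436226;
       416424214235256446454435315116236426414224326125137257355145124314434233;
       353154146127317415427237117327447466265464366167247457267246144242263161;
       362264166367465345225217115213221123313112131152164363461262243341421413;
       212422443451463361441462261163142121113211412431311332351141162352151231]);
  ((4, 7, 7)%N, 141221143223221323241321,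
   [:: 111321241233131341362242263343445365373172164262364154234246166147337417;
       227347427226416217236116137156357437317127247266274464472271173372171273;
       474376456475467277175167377257177367447466276477267255157176375174254275;
       465457476374366165146244443462272471261451331121113211421413311112313415;
       214334436356155163142161371473461363243222412424322132151361162352153251;
       441453252442463264256455265345326125144123225426346136216336355145124314;
       335354434235223143333213423411432444342422212231133141221323122224344332;
       324114315435245325115134232253452431351152353433454446425215135237117327;
       126316414312]);
  ((5, 5, 6)%N, 243141443341221422241442,
   [:: 111213333321441453254334315114313433331411432413533521542444425345225233;
       214415216426546554535336135154353451241442421541553455256446245125326116;
       236255456246126145355156346556436516524545526424322121113211131143155136;
       335215416536555356146226324222412514522543551532511523515316115314234132;
       212224144152351253151352344134153343445325423431452251232312414435454534;
       513525544552531512311112124323133235223244252231243141221422342354434332;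
       122242443341142123]);
  ((5, 6, 6)%N, 333435335455435533433535,
   [:: 111123142222324244364565463451241143164266465264252442562541522514315235;
       155356566464265466454556366345135156236116326516436316115314412211113121;
       311521513411212233221141162361551563461251131112214415216114126246166154;
       256136124226416215223125146165263161362561441462261163151231421413515536;
       346145243262452431351152133213225426546525423321313512414312331352232224;
       425446526534542332353554456444432424344545524334544354234253333435533453;
       355343245325445543555365564552342323443422434336535433531341322523511532;
       553363153255335455254134122242144132]);
  ((5, 6, 7)%N, 556366554364366347166367,
   [:: 111321522514434422223121311512322242432312113132342354256457537516524314;
       412431551563443451241143124222142332252442232213234114133253463264243235;
       216415517536557565544446467266364554353233214424416215335237117327247255;
       465453254464456444324534414426447567546345357336355334436455535556366347;
       326246344224245257236316126325526545346226425437445365555435225145265244;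
       454356146167155134333543423343553352153165157136144156137125315116135154;
       166367566547337527317127115217427525533413212231441462263161362552564466;
       267147227417515523511532452262164152351561542521513433531341421323122141;
       261163151361162363562541461251131112313211331411221123]);
  ((6, 6, 6)%N, 143353343153353543351541,
   [:: 111231212224126114216426616514612411621613511631643662641442652664656466;
       665646566356166145265163151361162141243262461651663561362161263343153165;
       146266164156366264252154256446526316115136335125144123142341421622412433;
       232431221213133253245455645626634655553352551653454644625415614516414215;
       236116326536416226124314515523322532544354452464254233432413434244443435;
       315334346444524323533545425345364563465453555635436534324422542554456255;
       445246225424234332344242223235333325135143353543535615513525546336355565;
       463365155134214222342552564666654556636624423633531512632611623642562363;
       261451661462441521331251131152351541522312122321241121311112313211113132]);
  ((6, 6, 7)%N, 434244436246324134124132,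
   [:: 111312522541331141261163151361551431221341322523625545564644542444342262;
       241121311112131211412314113125223321313512614622641662643631511613621633;
       423224232422632611623543555356364462652554535455254233214226427547566464;
       452251263161362343133213414316115217337127146347137156164152351332122242;
       162264166147126327117237157165267457656637517615627646634626647567366167;
       247367557565667655663651461442421413333435454352344323335354553534526624;
       636657467257265345357556654666546426434244324134236334533453432552544424;
       234215317116326527447466256446645525315235355253245143155365445325515635;
       425437456536346266465255353563665653443363153145225415513521441561463664;
       562642661451252132124222142154135336537617416514616417227246436516524532;
       612411531433243123144136216114212231]);
  ((6, 7, 7)%N, 333532313512532524332522,
   [:: 111123221141122321511312113233131211412613414316515413623611632512313112;
       133231421622423222142262472673661471463662461541533525427347467475665653;
       672651571372171273375367447426445246166145335536557655634435337325346547;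
       566574553534555354252442362563443545344143223343544446245455645633535334;
       254356436235333532524444324422542644564365373361342244364554474572652664;
       454462263473272253274255234132331521641561573671551631612514434314513415;
       225323315327117237135215227125146167377176157277175376256154162352371172;
       151341531451261363355457247266164374366165153174276257236134232152144136;
       124116326516537336526624522332351271173161241121311431621411212114126224;
       216417616637517615627646456666674576656635425226214424614626647527625523;
       322242452433643453243264465345353251441543562642432552654464663565546466;
       265163155147267477667675577657676556636617416217137156177275476677575567;
       357437317127115213]) ]%uint.

Lemma small_certs_valid : all valid_cert small_certs.
Proof. by vm_compute. Qed.

(** This is the negation of (a), (b) and (c) for three sides, stated symmetrically so that the sides
    need not be sorted: at most one side is 2, some side is at least 4, and some side is even. *)
Definition solvable_dims (a b c : nat) :=
  [&& 2 <= a, 2 <= b, 2 <= c, 2 <= (3 <= a) + (3 <= b) + (3 <= c),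
      [|| 4 <= a, 4 <= b | 4 <= c] & ~~ [&& odd a, odd b & odd c]].

Lemma small_certs_complete :
  let dims := map cert_dims small_certs in
  all (fun a => all (fun b => all (fun c => solvable_dims a b c ==>
    [|| (a, b, c) \in dims, (a, c, b) \in dims, (b, a, c) \in dims,
        (b, c, a) \in dims, (c, a, b) \in dims | (c, b, a) \in dims])
    (iota 2 6)) (iota 2 6)) (iota 2 6).
Proof. by vm_compute. Qed.

Definition board (ds : seq nat) : seq (seq nat) :=
  foldr (fun n B => [seq x :: p | x <- iota 1 n, p <- B]) [:: [::]] ds.

Lemma mem_board ds p : (p \in board ds) = onb ds p.
Proof.
elim: ds p => [|n ds IHds] [|x p] //=.
  by apply/allpairsPdep=> -[y [q []]].
apply/allpairsPdep/idP => [[y [q [y_n q_b [-> ->]]]]|/andP[x_n p_b]].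
  by rewrite -IHds q_b andbT -ltnS; move: y_n; rewrite mem_iota add1n.
by exists x, p; rewrite IHds p_b mem_iota add1n.
Qed.

Lemma uniq_board ds : uniq (board ds).
Proof.
elim: ds => //= n ds IHds; apply: allpairs_uniq => //; first exact: iota_uniq.
by move=> [x p] [y q] _ _ /= [-> ->].
Qed.

Lemma size_board ds : size (board ds) = foldr muln 1 ds.
Proof. by elim: ds => //= n ds IHds; rewrite size_allpairs size_iota IHds. Qed.

Lemma valid_cert_extensible k : valid_cert k ->
  let: (a, b, c) := cert_dims k in extensible a b c (cert_tour k).
Proof.
rewrite /valid_cert; case: (cert_dims k) => [[a b] c].
set t := cert_tour k; case/and5P=> gt2_t /eqP size_t onb_t uniq_t.
case/and4P=> adj_t tops_t bots_t sites_t; split=> //.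
- split=> //; first by rewrite cycle_links.
  have sub_t : {subset t <= board [:: a; b; c]}.
    by move=> p /(allP onb_t); rewrite mem_board.
  (* Pigeonhole: a duplicate-free list within the board and of the same size contains every point of
     the board. *)
  have [|_ eq_t] := uniq_min_size uniq_t sub_t.
    by rewrite size_board size_t /= muln1 mulnA.
  by move=> p; rewrite eq_t mem_board.
move: sites_t.
case: (cert_sites k) => [|p1 [|q1 [|p2 [|q2 [|p3 [|q3 [|p4 [|q4 []]]]]]]]] //.
case/and4P=> lk sites dl dl_tops.
by exists (p1, q1), (p2, q2), (p3, q3), (p4, q4).
Qed.

Lemma small_boards a b c : a <= 7 -> b <= 7 -> c <= 7 -> solvable_dims a b c ->
  exists t, extensible a b c t.
Proof.
move=> a7 b7 c7 abc; have range n : 2 <= n -> n <= 7 -> n \in iota 2 6.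
  by rewrite mem_iota => -> /=.
have cert a' b' c' : (a', b', c') \in map cert_dims small_certs ->
    exists t, extensible a' b' c' t.
  elim: small_certs small_certs_valid => //= k ks IHks /andP[valid_k /IHks{}IHks].
  rewrite inE => /predU1P[dims_k|//]; have := valid_cert_extensible valid_k.
  by rewrite -dims_k; exists (cert_tour k).
have s01 a' b' c' : (exists t, extensible a' b' c' t) ->
    exists t, extensible b' a' c' t.
  by case=> t /extensible_swap01; exists (map swap01 t).
have s12 a' b' c' : (exists t, extensible a' b' c' t) ->
    exists t, extensible a' c' b' t.
  by case=> t /extensible_swap12; exists (map swap12 t).
have /and5P[a2 b2 c2 _ _] := abc.
have /allP/(_ a (range a a2 a7))/allP/(_ b (range b b2 b7)) := small_certs_complete.
move/allP/(_ c (range c c2 c7))/implyP/(_ abc).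
(* Words in the two transpositions produce all six orders of the sides. *)
case/or4P=> [||| /or3P[]] /cert ext; first exact: ext.
- exact: s12.
- exact: s01.
- exact/s01/s12.
- exact/s12/s01.
- exact/s12/s01/s12.
Qed.

(** * Tours on all admissible boxes *)

Lemma solvable_dims_swap01 a b c : solvable_dims a b c = solvable_dims b a c.
Proof.
by rewrite /solvable_dims andbCA (addnC (3 <= a)) (orbCA (4 <= a)) (andbCA (odd a)).
Qed.

Lemma solvable_dims_swap12 a b c : solvable_dims a b c = solvable_dims a c b.
Proof.
rewrite /solvable_dims (andbCA (2 <= b)) (addnAC (3 <= a)) (orbC (4 <= b)).
by rewrite (andbC (odd b)).
Qed.

(** Both [a - 4] and 4 are at least 4, which keeps the size conditions; subtracting 4 preserves
    parity, and 4 is itself even. *)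
Lemma solvable_dims_sub4 a b c : 8 <= a -> solvable_dims a b c ->
  solvable_dims (a - 4) b c /\ solvable_dims 4 b c.
Proof.
move=> a8 /and5P[_ b2 c2 ge3 /andP[_ odd_abc]].
case: a a8 ge3 odd_abc => [|[|[|[|[|[|[|[|a]]]]]]]] // _ ge3 odd_abc.
by rewrite /solvable_dims /= b2 c2 ge3; move: odd_abc; rewrite /= !negbK => ->.
Qed.

(** Induction on the sum of the sides: a side of length at least 8 is brought to the first place and
    cut into [a - 4] and 4; if there is none, the listed tours apply. *)
Lemma solvable_extensible a b c : solvable_dims a b c ->
  exists t, extensible a b c t.
Proof.
have [m] := ubnP (a + b + c); elim: m a b c => // m IHm.
have large a b c : a + b + c < m.+1 -> 8 <= a -> solvable_dims a b c ->
    exists t, extensible a b c t.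
  move=> lt_m a8 /(solvable_dims_sub4 a8)[].
  have a4 : 4 <= a by apply: leq_trans a8.
  have lt_abc k : k < a -> k + b + c < m.
    by move=> lt_k; rewrite -ltnS (leq_trans _ lt_m) // ltnS !ltn_add2r.
  case/IHm => [|t1 ext1]; first by rewrite lt_abc // ltn_subrL (leq_trans _ a4).
  case/IHm => [|t2 ext2]; first by rewrite lt_abc // (leq_trans _ a8).
  have [|t ext_t] := extend _ ext1 ext2; first by rewrite leq_subRL // (leq_trans _ a8).
  by exists t; rewrite -(subnK a4).
move=> a b c lt_m abc.
have [a8|a7] := leqP 8 a; first exact: large.
have [b8|b7] := leqP 8 b.
  have [||t /extensible_swap01 ext_t] := large b a c _ b8.
  - by rewrite (addnC b).
  - by rewrite solvable_dims_swap01.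
  by exists (map swap01 t).
have [c8|c7] := leqP 8 c; last exact: small_boards.
have [||t /extensible_swap01/extensible_swap12 ext_t] := large c a b _ c8.
- by rewrite -addnA addnC.
- by rewrite solvable_dims_swap01 solvable_dims_swap12.
by exists (map swap12 (map swap01 t)).
Qed.

Lemma stack_all ds a b c : solvable_dims a b c -> all (leq 2) ds ->
  exists t, tour (ds ++ [:: a; b; c]) t.
Proof.
move=> abc ds2; suff [t []] : exists t,
    tour (ds ++ [:: a; b; c]) t /\ sited [::] t by exists t.
elim: ds ds2 => [_|n ds IHds /= /andP[n2 /IHds[t [tour_t site_t]]]]; last first.
  exact: stack tour_t site_t n2.
have [t [tour_t _ _ [e1 [f1 [e2 [f2 [lk sites dl _]]]]]]] := solvable_extensible abc.
by exists t; split=> //; exists e1, f1, e2, f2; split.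
Qed.

(** * Lists of coordinates and points of the chessboard *)

Section Transfer.

Variables (k : nat) (n : 'I_k -> nat) (l : seq 'I_k).
Hypothesis perm_l : perm_eq l (enum 'I_k).

Let uniq_l : uniq l. Proof. by rewrite (perm_uniq perm_l) enum_uniq. Qed.

Let mem_l i : i \in l. Proof. by rewrite (perm_mem perm_l) mem_enum. Qed.

(** The order [l] of the axes is left free: the construction needs three chosen axes at the end. *)
Definition coords (a : point k) := map a l.

Definition of_coords (p : seq nat) : point k := [ffun i => nth 0 p (index i l)].

Lemma coordsK : cancel coords of_coords.
Proof.
move=> a; apply/ffunP=> i; rewrite ffunE /coords.
by rewrite (nth_map i) ?index_mem ?mem_l // nth_index ?mem_l.
Qed.

Lemma of_coordsK p : size p = k -> coords (of_coords p) = p.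
Proof.
move=> size_p; have size_l : size l = k.
  by rewrite (perm_size perm_l) -cardE card_ord.
rewrite /coords; move: size_p; rewrite -[RHS]size_l => size_p.
transitivity [seq nth 0 p j | j <- [seq index i l | i <- l]].
  by rewrite -map_comp; apply: eq_map => i; rewrite /= ffunE.
have -> : [seq index i l | i <- l] = iota 0 (size l).
  apply: (@eq_from_nth _ 0) => [|j]; first by rewrite size_map size_iota.
  case: l uniq_l => // i0 l' uniq_l'; rewrite size_map => lt_j.
  by rewrite (nth_map i0) // index_uniq // nth_iota.
by rewrite -size_p map_nth_iota0 // take_size.
Qed.

Lemma on_board_coords a : onb (map n l) (coords a) = on_board n a.
Proof.
rewrite /onb /coords; have -> : all2 (fun m x => 0 < x <= m) (map n l) (map a l)
    = all (fun i => 0 < a i <= n i) l by elim: (l) => //= i s ->.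
apply/allP/forallP => [H i|H i _]; [exact/H/mem_l | exact: H].
Qed.

Lemma count_coords (P : pred nat) a b :
  count P (dists (coords a) (coords b)) = #|[set i | P (ndist (a i) (b i))]|.
Proof.
rewrite /dists /coords zip_map -map_comp count_map (permP perm_l).
by rewrite cardsE cardE [in RHS]/enum_mem size_filter -enumT; apply: eq_count.
Qed.

Lemma kadj_coords a b : kadj (coords a) (coords b) = knight_adj a b.
Proof.
rewrite /kadj /knight_adj !count_coords; congr [&& _, _ & _].
rewrite /dists /coords zip_map -map_comp all_map.
apply/allP/forallP => [H i|H i _].
  by have /= := H i (mem_l i); case: ndist => [|[|[]]].
by have /= := H i; case: ndist => [|[|[]]].
Qed.

Lemma closed_knight_tour_of_coords t :
  tour (map n l) t -> closed_knight_tour n (map of_coords t).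
Proof.
move=> tour_t; case: (tour_t) => gt2_t uniq_t cyc_t mem_t.
have size_l : size l = k by rewrite (perm_size perm_l) -cardE card_ord.
have coords_t p : p \in t -> coords (of_coords p) = p.
  by move/(tour_size tour_t); rewrite size_map size_l; apply: of_coordsK.
split.
- by rewrite size_map.
- rewrite map_inj_in_uniq // => p q /coords_t {2}<- /coords_t {2}<-.
  by move->.
- by apply/allP=> _ /mapP[p p_t ->]; rewrite -on_board_coords coords_t // -mem_t.
- move=> a; rewrite -on_board_coords -mem_t => a_t.
  by apply/mapP; exists (coords a); rewrite ?coordsK.
have : cycle (fun p q => knight_adj (of_coords p) (of_coords q)) t.
  have sub : {in mem t &, subrel kadj
      (fun p q => knight_adj (of_coords p) (of_coords q))}.
    by move=> p q p_t q_t; rewrite -kadj_coords !coords_t.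
  by apply: sub_in_cycle sub _ _ cyc_t; apply/allP.
by rewrite cycle_map.
Qed.

Lemma tour_coords c : closed_knight_tour n c -> tour (map n l) (map coords c).
Proof.
case=> gt2_c uniq_c onb_c mem_c cyc_c; split.
- by rewrite size_map.
- by rewrite map_inj_uniq //; apply: can_inj coordsK.
- by rewrite cycle_map; apply: sub_cycle cyc_c => a b; rewrite /= kadj_coords.
move=> p; apply/mapP/idP => [[a a_c ->]|p_b].
  by rewrite on_board_coords (allP onb_c).
have size_l : size l = k by rewrite (perm_size perm_l) -cardE card_ord.
have p_k : size p = k by move: p_b; rewrite /onb all2E size_map size_l => /andP[/eqP].
exists (of_coords p); last by rewrite of_coordsK.
by apply: mem_c; rewrite -on_board_coords of_coordsK.
Qed.

End Transfer.

(** * Obstructions to closed tours *)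

(** The distance of two coordinates has the parity of their sum, and the distances of a knight move
    add up to 1 + 2. *)
Lemma kadj_odd p q : size p = size q -> kadj p q ->
  odd (sumn p) = ~~ odd (sumn q).
Proof.
move=> eq_sz /and3P[/eqP one_d /eqP two_d le2_d].
suff : odd (sumn p) (+) odd (sumn q).
  by case: odd; case: odd.
have -> : odd (sumn p) (+) odd (sumn q) = odd (sumn (dists p q)).
  elim: p q eq_sz {one_d two_d le2_d} => [|x p IHp] [|y q] //= [/IHp].
  rewrite /dists /= !oddD => <-.
  have -> : odd (x - y) (+) odd (y - x) = odd x (+) odd y.
    case: (leqP x y) => [le_xy|/ltnW le_yx].
      by rewrite (eqP le_xy) oddB //= addbC.
    by rewrite (eqP le_yx) oddB // addbF.
  by rewrite !addbA [X in X (+) _]addbAC.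
have -> : sumn (dists p q) = count_mem 1 (dists p q) + (count_mem 2 (dists p q)).*2.
  elim: (dists p q) le2_d => //= d ds IHds /andP[d2 /IHds->].
  move: (count_mem 1 ds) (count_mem 2 ds) => m1 m2.
  case: d d2 => [|[|[|//]]] /= _; first by rewrite !add0n.
    by rewrite [0 + m2]add0n addnA.
  by rewrite add0n doubleD addnCA.
by rewrite one_d two_d.
Qed.

(** The colours at the two ends of the opened cycle differ according to the parity of the number of
    steps, and the closing link forces them to differ. *)
Lemma cycle_alternating (T : eqType) (col : T -> bool) (c : seq T) :
  cycle (fun x y => col x != col y) c -> ~~ odd (size c).
Proof.
case: c => //= x s.
have path_odd y : path (fun x y => col x != col y) y s ->
    col (last y s) = odd (size s) (+) col y.
  elim: s y => //= z s IHs y /andP[yz /IHs->].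
  by case: odd (col y) (col z) yz => [] [] [].
rewrite rcons_path negbK => /andP[/path_odd ->].
by case: odd (col x) => [] [].
Qed.

(** Moves alternate the parity of the coordinate sum, but the number of points, a product of odd
    sides, is odd. *)
Lemma no_tour_odd ds t : all odd ds -> ~ tour ds t.
Proof.
move=> odd_ds tour_t; case: (tour_t) => _ uniq_t cyc_t mem_t.
have : ~~ odd (size t).
  apply: (@cycle_alternating _ (odd \o sumn)).
  have sub : {in mem t &, subrel kadj
      (fun p q => (odd \o sumn) p != (odd \o sumn) q)}.
    move=> p q /(tour_size tour_t) p_ds /(tour_size tour_t) q_ds.
    by move/kadj_odd => /= ->; [case: odd | rewrite p_ds].
  by apply: sub_in_cycle sub _ _ cyc_t; apply/allP.
have /perm_size -> : perm_eq t (board ds).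
  by apply: uniq_perm => // [|p]; rewrite ?uniq_board // mem_t mem_board.
rewrite size_board; elim: (ds) odd_ds => //= d ds' IHds /andP[d_odd /IHds].
by rewrite oddM d_odd.
Qed.

Lemma cycle_constant (T S : eqType) (h : T -> S) (c : seq T) x y :
  cycle (fun x y => h x == h y) c -> x \in c -> y \in c -> h x = h y.
Proof.
case: c => //= z s; rewrite rcons_path => /andP[z_s _].
suff const : {in z :: s, forall u, h u = h z} by move=> /const-> /const->.
elim: s z z_s => [|v s IHs] z /= => [_ u|/andP[/eqP zv v_s] u].
  by rewrite inE => /eqP->.
by rewrite inE => /predU1P[->//|/(IHs _ v_s)->].
Qed.

Lemma knight_adj_two k (a b : point k) :
  knight_adj a b -> exists j, ndist (a j) (b j) = 2.
Proof.
case/and3P=> _ /cards1P[j eq_j] _; exists j; apply/eqP.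
by have := set11 j; rewrite -eq_j inE.
Qed.

(** A coordinate confined to 1 and 2 cannot change by 2, so every move changes coordinate [i] by
    exactly 2. *)
Lemma no_tour_thin k (n : 'I_k -> nat) (i : 'I_k) :
    (forall j, 2 <= n j) -> (forall j, j != i -> n j = 2) ->
  ~ has_closed_knight_tour n.
Proof.
move=> n2 thin [c [_ _ onb_c mem_c cyc_c]].
have coord a j : on_board n a -> 1 <= a j <= n j by move/forallP.
have cyc_par : cycle (fun a b : point k => odd (a i) == odd (b i)) c.
  have sub : {in on_board n &, subrel (@knight_adj k)
      (fun a b => odd (a i) == odd (b i))}.
    move=> a b a_b b_b /knight_adj_two[j dist2].
    have [eq_ji|/thin n_j] := eqVneq j i; last first.
      move: (coord a j a_b) (coord b j b_b) dist2; rewrite n_j.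
      by case: (a j) (b j) => [|[|[|]]] // [|[|[|]]].
    rewrite -eq_ji; have := congr1 odd dist2; rewrite /ndist.
    case: (leqP (a j) (b j)) => [le_ab|/ltnW le_ba].
      by rewrite (eqP le_ab) add0n oddB //=; case: odd; case: odd.
    by rewrite (eqP le_ba) addn0 oddB //=; case: odd; case: odd.
  exact: sub_in_cycle sub _ onb_c cyc_c.
(* These two points of the board have 1 and 2 as coordinate [i], hence different parities. *)
pose low : point k := [ffun _ => 1]; pose high : point k := [ffun j => (j == i).+1].
have low_c : low \in c.
  by apply: mem_c; apply/forallP=> j; rewrite ffunE /= (ltnW (n2 j)).
have high_c : high \in c.
  by apply: mem_c; apply/forallP=> j; rewrite ffunE /= (leq_trans _ (n2 j)) //; case: eqP.
have := cycle_constant (h := fun a : point k => odd (a i)) cyc_par low_c high_c.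
by rewrite !ffunE eqxx.
Qed.

Lemma no_tour_small k (n : 'I_k -> nat) :
  (forall j, 2 <= n j <= 3) -> ~ has_closed_knight_tour n.
Proof.
move=> n23 [c [_ _ onb_c mem_c cyc_c]]; pose mid : point k := [ffun _ => 2].
have mid_c : mid \in c.
  by apply: mem_c; apply/forallP=> j; rewrite ffunE /=; case/andP: (n23 j).
(* The successor of [mid] would have a coordinate at distance 2 from 2, outside the range from 1 to
   3. *)
have /knight_adj_two[j] := next_cycle cyc_c mid_c.
have /forallP/(_ j) := allP onb_c (next c mid) (etrans (mem_next c mid) mid_c).
have /andP[_ n3] := n23 j; case/andP=> gt0 /leq_trans/(_ n3) le3.
by rewrite ffunE; case: (next c mid j) gt0 le3 => [|[|[|[|]]]].
Qed.

Unset Implicit Arguments.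

Theorem theorem1p3 (k : nat) (hk : (3 <= k)%N) (n : 'I_k -> nat)
    (h2 : forall i : 'I_k, (2 <= n i)%N)
    (hmono : forall i j : 'I_k, (i <= j)%N -> (n i <= n j)%N) :
  ~ has_closed_knight_tour n <->
  [\/ (forall i : 'I_k, odd (n i)),
      (exists i : 'I_k, val i = k.-2 /\ n i = 2) |
      (exists i : 'I_k, val i = k.-1 /\ n i = 3)].
Proof.
split=> [no_tour|]; last first.
  case=> [odd_n|[i [i_k n_i]]|[i [i_k n_i]]].
  - case=> c /(tour_coords (perm_refl _)) tour_c; apply: no_tour_odd tour_c.
    by apply/allP=> _ /mapP[i _ ->].
  (* Axes are numbered from 0, so [k.-2] carries the second largest side; by monotonicity every axis
     but the last has side 2. *)
  - have lt_k : k.-1 < k by case: (k) hk.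
    apply: (@no_tour_thin _ _ (Ordinal lt_k)) => // j j_last.
    apply/eqP; rewrite eqn_leq h2 -n_i andbT; apply: hmono; rewrite [val i]i_k.
    have := ltn_ord j; move: j_last; rewrite -val_eqE /=.
    move: (nat_of_ord j) => d; case: (k) hk => [|[|m]] // _.
    by rewrite ltnS leq_eqVlt => /negPf->.
  - apply: no_tour_small => j; rewrite h2 -n_i hmono // [val i]i_k.
    by rewrite -ltnS prednK ?ltn_ord //; case: (k) hk.
have lt_pen : k.-2 < k by case: (k) hk => [|[|m]].
have lt_last : k.-1 < k by case: (k) hk.
pose pen := Ordinal lt_pen; pose lst := Ordinal lt_last.
have [odd_n|] := boolP [forall i, odd (n i)]; first by apply: Or31; apply/forallP.
rewrite negb_forall => /existsP[i0 even_i0].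
have [pen2|pen2] := eqVneq (n pen) 2; first by apply: Or32; exists pen.
have [lst3|lst3] := eqVneq (n lst) 3; first by apply: Or33; exists lst.
case: no_tour; have pen3 : 3 <= n pen by rewrite ltn_neqAle eq_sym pen2 h2.
have le_pl : n pen <= n lst by apply: hmono; rewrite /= leq_pred.
have lst4 : 4 <= n lst by rewrite ltn_neqAle eq_sym lst3 (leq_trans pen3).
have k2_gt0 : 0 < k.-2 by case: (k) hk => [|[|[|]]].
have lt_pl : k.-2 < k.-1 by case: (k) hk => [|[|m]].
have last_two d : d < k -> k.-2 <= d -> (d == k.-2) || (d == k.-1).
  case: (k) hk => [|[|m]] //= _; rewrite ltnS leq_eqVlt ltnS => /orP[->|le_d ge_d].
    by rewrite orbT.
  by rewrite eqn_leq le_d ge_d.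
(* The third axis is the one with an even side, unless that is among the last two; then axis 0
   serves, which is below [k.-2] because [k] is at least 3. *)
pose j := if i0 < k.-2 then i0 else Ordinal (ltnW (ltnW hk)).
have lt_j : j < k.-2.
  by rewrite /j; case: ifP.
have abc : solvable_dims (n j) (n pen) (n lst).
  rewrite /solvable_dims !h2 pen3 lst4 (leq_trans pen3 le_pl) !orbT /=.
  have -> /= : 1 < (2 < n j) + true + true by case: (2 < n j).
  apply: contra even_i0 => /and3P[odd_j odd_pen odd_lst].
  move: odd_j; rewrite /j; case: ifP => // /negbT; rewrite -leqNgt => ge_i0 _.
  have : (i0 == pen) || (i0 == lst).
    by rewrite -!val_eqE /= last_two.
  by case/orP=> /eqP->.
pose trio := [:: j; pen; lst].
(* The three chosen axes come last because stacking adds the remaining ones in front. *)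
pose l := [seq i <- enum 'I_k | i \notin trio] ++ trio.
have perm_l : perm_eq l (enum 'I_k).
  apply: uniq_perm; last 1 first.
  - by move=> i; rewrite mem_cat mem_filter mem_enum andbT orNb.
  - rewrite cat_uniq filter_uniq ?enum_uniq //; apply/and3P; split=> //.
      by apply/hasPn=> i i_trio; rewrite mem_filter i_trio.
    rewrite /= !inE andbT -!val_eqE /= negb_or (ltn_eqF lt_j).
    by rewrite !ltn_eqF // (ltn_trans lt_j).
  exact: enum_uniq.
have [|t tour_t] := @stack_all [seq n i | i <- enum 'I_k & i \notin trio] _ _ _ abc.
  by apply/allP=> _ /mapP[i _ ->].
exists (map (of_coords l) t); apply: closed_knight_tour_of_coords => //.
by rewrite map_cat.
Qed.
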